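(* Let $n\ge 1$, and let $so(2n+1,\mathbb{C})\subset sl(2n+1,\mathbb{C})$ be the subalgebra of matrices skew-adjoint relative to the quadratic form $\sum_{i=1}^{n+1}z_iz_{2n+2-i}$. The standard $so(2n+1,\mathbb{C})$-compatible parabolic subalgebras of $sl(2n+1,\mathbb{C})$ are exactly those $\mathfrak{p}_\Pi$, $\Pi\subseteq\Delta=\{\alpha_k-\alpha_{k+1}\mid 1\le k\le 2n\}$, such that for all $1\le k\le n$ either $\{\alpha_k-\alpha_{k+1},\ \alpha_{2n+1-k}-\alpha_{2n+2-k}\}\subseteq\Pi$ or $\{\alpha_k-\alpha_{k+1},\ \alpha_{2n+1-k}-\alpha_{2n+2-k}\}\cap\Pi=\emptyset$.
   Context: The Cartan subalgebra $\mathfrak{h}$ of $\mathfrak{g}=sl(2n+1,\mathbb{C})$ is the set of trace-zero diagonal matrices, $\alpha_k(\mathrm{diag}(a_1,\dots,a_{2n+1}))=a_k$, and $\Delta$ is the simple system $\{\alpha_k-\alpha_{k+1}\mid 1\le k\le 2n\}$ with positive system $\Phi^+$. The diagonal matrices in $so(2n+1,\mathbb{C})$, namely $\mathrm{diag}(b_1,\dots,b_n,0,-b_n,\dots,-b_1)$, form a Cartan subalgebra of it. For $\Pi\subseteq\Delta$, the standard parabolic subalgebra is $\mathfrak{p}_\Pi=\mathfrak{h}+\sum_{\alpha\in\Phi^+}\mathfrak{g}_\alpha+\sum_{\alpha\in\mathbb{N}\Pi\cap\Phi^+}\mathfrak{g}_{-\alpha}$, where $\mathfrak{g}_\alpha$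 is the root space of $\alpha$ and $\mathbb{N}\Pi$ denotes the non-negative integer combinations of elements of $\Pi$. A semisimple element $H\in\mathfrak{g}$ is hyperbolic if all eigenvalues of $\mathrm{ad}(H)$ on $\mathfrak{g}$ are real; for such $H$, $\mathfrak{p}(H)$ is the sum of the eigenspaces of $\mathrm{ad}(H)$ with eigenvalues $\ge 0$, a parabolic subalgebra of $\mathfrak{g}$. For a reductive subalgebra $\mathfrak{g}'$ of $\mathfrak{g}$, a parabolic subalgebra $\mathfrak{p}$ of $\mathfrak{g}$ is $\mathfrak{g}'$-compatible if there exists $H\in\mathfrak{g}'$, hyperbolic as an element of $\mathfrak{g}$, with $\mathfrak{p}=\mathfrak{p}(H)$. *)

(* Defs.v *)
From HB Require Import structures.
From mathcomp Require Export all_boot all_order all_algebra.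
From mathcomp Require Export boolp classical_sets fsbigop reals.
From mathcomp Require Export complex.
Set Implicit Arguments.
Unset Strict Implicit.
Unset Printing Implicit Defensive.
Import Order.TTheory GRing.Theory Num.Theory.
Local Open Scope classical_set_scope.
Local Open Scope ring_scope.

Section MatrixLieAlgebra.
Variables (R : realType) (m : nat).
Local Notation C := R[i].
Implicit Types (g p : {vspace 'M[C]_m}) (H X : 'M[C]_m).

Definition ad H : 'End('M[C]_m) := linfun (mulmx H \- mulmxr H).

Lemma adE H X : ad H X = H *m X - X *m H.
Proof. by rewrite lfunE. Qed.

Definition ad_eigenspace g H (a : C) : {vspace 'M[C]_m} :=
  (g :&: passmx.leigenspace (ad H) a)%VS.

Lemma mem_ad_eigenspace g H a X :
  (X \in ad_eigenspace g H a) = (X \in g) && (ad H X == a *: X).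
Proof.
by rewrite memv_cap memv_ker add_lfunE opp_lfunE scale_lfunE id_lfunE subr_eq0.
Qed.

(* ad H is diagonalizable on g: g has a basis of eigenvectors *)
Definition semisimple_elt g H : Prop :=
  H \in g /\
  exists2 X : seq 'M[C]_m, basis_of g X &
    {in X, forall x, exists a : C, x \in ad_eigenspace g H a}.

Definition hyperbolic g H : Prop :=
  semisimple_elt g H /\
  forall a : C, ad_eigenspace g H a != 0%VS -> a \is Num.real.

(* In the order of R[i], 0 <= a says that a is real and non-negative.  The sum
   is the finitely supported one, ad H having finitely many eigenvalues. *)
Definition parabolic_of g H : {vspace 'M[C]_m} :=
  \big[addv/0%VS]_(a \in [set a : C | 0 <= a]) ad_eigenspace g H a.

(* p is not assumed parabolic: for g reductive and H hyperbolic, parabolic_of g H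
   always is. *)
Definition compatible g (g' : set 'M[C]_m) p : Prop :=
  exists H, [/\ g' H, hyperbolic g H & p = parabolic_of g H].

End MatrixLieAlgebra.

Section SpecialLinear.
Variables (R : realType) (n : nat).
Local Notation C := R[i].
Local Notation N := (2 * n).+1%N.

(* the i-th index, numbered from 1: meaningful for 1 <= i <= 2n+1 *)
Definition ix (i : nat) : 'I_N := inord i.-1.

Definition sl : {vspace 'M[C]_N} := lker (linfun (@mxtrace C N : _ -> C^o)).

Lemma mem_sl X : (X \in sl) = (\tr X == 0).
Proof. by rewrite memv_ker lfunE. Qed.

Definition cartan : {vspace 'M[C]_N} := (sl :&: limg (linfun (@diag_mx C N)))%VS.

Lemma mem_cartan X : (X \in cartan) = (\tr X == 0) && is_diag_mx X.
Proof.
rewrite memv_cap mem_sl; congr (_ && _); apply/memv_imgP/diag_mxP => -[d].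
  by move=> _ ->; exists d; rewrite lfunE.
by move=> ->; exists d; rewrite ?memvf ?lfunE.
Qed.

(* the dual space of the Cartan subalgebra *)
Definition weight : Type := 'Hom(subvs_of cartan, C^o).
HB.instance Definition _ := Vector.on weight.
Implicit Types (a b : weight) (Pi : set weight).

Definition diag_entry (k : nat) (H : subvs_of cartan) : C^o :=
  vsval H (ix k) (ix k).

Fact diag_entry_is_linear k : linear (diag_entry k).
Proof. by move=> c A B; rewrite /diag_entry linearP !mxE. Qed.
HB.instance Definition _ k :=
  GRing.isLinear.Build C (subvs_of cartan) C^o _ _ (diag_entry_is_linear k).

Definition alpha (k : nat) : weight := linfun (diag_entry k).

Lemma alphaE k (H : subvs_of cartan) : alpha k H = vsval H (ix k) (ix k).
Proof. by rewrite lfunE. Qed.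

Definition Delta : set weight :=
  [set alpha k - alpha k.+1 | k in [set k | (1 <= k <= 2 * n)%N]].

(* It is enough to test the eigenvector condition on a basis of the Cartan
   subalgebra; see [mem_root_space]. *)
Definition root_space a : {vspace 'M[C]_N} :=
  (sl :&: \bigcap_(H <- vbasis {:subvs_of cartan})
            passmx.leigenspace (ad (vsval H)) (a H))%VS.

Lemma mem_root_space a X :
  X \in root_space a <->
  X \in sl /\ forall H : subvs_of cartan, ad (vsval H) X = a H *: X.
Proof.
have -> : (X \in root_space a) = (X \in sl) &&
    all (fun H => ad (vsval H) X == a H *: X) (vbasis {:subvs_of cartan}).
  rewrite memv_cap; congr (_ && _).
  elim: (tval _) => [|H s IHs]; first by rewrite big_nil memvf.
  rewrite big_cons memv_cap IHs /= memv_ker.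
  by rewrite add_lfunE opp_lfunE scale_lfunE id_lfunE subr_eq0.
split=> [/andP[Xsl /allP aX]|[Xsl aX]]; last first.
  by rewrite Xsl; apply/allP => H _; apply/eqP/aX.
pose vb := vbasis {:subvs_of cartan}.
have aXi i : ad (vsval vb`_i) X = a vb`_i *: X.
  have [iB|] := ltnP i (size vb); first exact/eqP/aX/mem_nth.
  by move=> /(nth_default 0)->; rewrite adE !(linear0, mul0mx, mulmx0, subr0, scale0r).
split=> // H; rewrite (coord_vbasis (memvf H)) !linear_sum scaler_suml adE.
rewrite mulmx_suml mulmx_sumr -sumrB; apply: eq_bigr => i _ /=.
by rewrite -scalemxAl -scalemxAr -scalerBr -adE aXi scalerA [a (_ *: _)]linearZ.
Qed.

Definition Phi : set weight := [set a | a != 0 /\ root_space a != 0%VS].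

(* the combinations of elements of Pi with coefficients in nat *)
Definition NN Pi : set weight :=
  [set a | exists (s : seq weight) (c : weight -> nat),
     {in s, forall b, Pi b} /\ a = \sum_(b <- s) b *+ c b].

Definition Phi_plus : set weight := Phi `&` NN Delta.

(* Both sums are finitely supported, Phi being finite. *)
Definition std_parabolic Pi : {vspace 'M[C]_N} :=
  (cartan + \big[addv/0%VS]_(a \in Phi_plus) root_space a
          + \big[addv/0%VS]_(a \in NN Pi `&` Phi_plus) root_space (- a))%VS.

Definition quad_form (z : 'cV[C]_N) : C :=
  \sum_(1 <= i < n.+2) z (ix i) 0 * z (ix (2 * n + 2 - i)%N) 0.

Definition polar_form (z w : 'cV[C]_N) : C :=
  quad_form (z + w) - quad_form z - quad_form w.

Definition so : set 'M[C]_N :=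
  [set X | X \in sl /\
     forall z w : 'cV[C]_N, polar_form (X *m z) w + polar_form z (X *m w) = 0].

End SpecialLinear.

Arguments Delta : clear implicits.
Arguments Phi : clear implicits.
Arguments Phi_plus : clear implicits.
Arguments so : clear implicits.

(* Main.v *)
Require Import Defs.
From HB Require Import structures.
From mathcomp Require Import cardinality zify ring.
Set Implicit Arguments.
Unset Strict Implicit.
Unset Printing Implicit Defensive.
Import Order.TTheory GRing.Theory Num.Theory.
Local Open Scope classical_set_scope.
Local Open Scope ring_scope.

(** Both kinds of parabolic subalgebra consist of the trace-zero matrices whose
entries are confined to certain positions.  For the standard one attached to
Pi, a position (i, j) below the diagonal is allowed when every simple root
between j and i lies in Pi ([mem_std_parabolic]); for that of a diagonal H, a
position (i, j) is allowed when H_jj <= H_ii ([mem_parabolic_diag]).  The first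
description rests on evaluating roots at the fundamental coweights, which read
off the coefficient of each simple root.

Compatibility forces the symmetry of Pi.  The element H of the orthogonal
algebra need not be diagonal, but no conjugation is required: with B the Gram
matrix of the polar form, X |-> - B^-1 X^T B is an automorphism of sl fixing
the orthogonal algebra pointwise, so it commutes with ad H and preserves each
eigenspace of ad H, hence the parabolic subalgebra ([twist_parabolic]).  It
sends the root vector E_(m+1, m) to a nonzero multiple of the one in the mirror
position with respect to the antidiagonal, and that root vector is in the
standard parabolic subalgebra only if its simple root is in Pi
([std_parabolic_mirror]).

Conversely, take a real diagonal H whose m-th entry is equal to the next one
when the m-th simple root is in Pi, and larger than it otherwise.  By the two
descriptions above, H defines the standard parabolic subalgebra of Pi
([grading_elt_parabolic]).  If all the steps have the same size and Pi is
symmetric, adding a constant makes the entries skew under the reversal of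
indices, so that H is in the orthogonal algebra ([grading_elt_so]). *)

(** * Sums of subspaces over a set with finite support *)

Section FiniteSums.
Variables (K : fieldType) (V : vectType K) (I : choiceType).
Implicit Types (A : set I) (F : I -> {vspace V}).

Lemma fsumv_ind (P : V -> Prop) A F :
    P 0 -> (forall x y, P x -> P y -> P (x + y)) ->
    (forall a x, A a -> x \in F a -> P x) ->
  forall x, x \in (\big[addv/0%VS]_(a \in A) F a)%VS -> P x.
Proof.
move=> P0 PD PF.
have nilP x : x \in (\sum_(a <- [::]) F a)%VS -> P x.
  by rewrite big_nil memv0 => /eqP->.
case: finite_supportP => [_|X XA _ _]; first exact: nilP.
have {}XA a : a \in finmap.enum_fset X -> A a := XA a.
elim: (finmap.enum_fset X) XA => [_|a r IHr rA] x; first exact: nilP.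
rewrite big_cons => /memv_addP[u uF [v vr ->]].
apply: PD; first by apply: PF uF; apply: rA; rewrite mem_head.
by apply: IHr vr => b br; apply: rA; rewrite inE br orbT.
Qed.

(** A sum over a set with infinite support is zero by convention, so membership
of the summands needs a bound on the support: here, the image of a finite
type. *)
Lemma memv_fsum A F (T : finType) (f : T -> I) a x :
    (forall b, A b -> F b != 0%VS -> exists t, b = f t) ->
  A a -> x \in F a -> x \in (\big[addv/0%VS]_(a \in A) F a)%VS.
Proof.
move=> suppF Aa xFa.
have [Fa0|Fa0] := eqVneq (F a) 0%VS.
  by move: xFa; rewrite Fa0 memv0 => /eqP->; exact: mem0v.
have fin : finite_set (A `&` F @^-1` [set~ 0%VS]).
  apply: (@sub_finite_set _ _ (range f)); last exact: finite_image.
  by move=> b [/suppF bf /= /eqP/bf[t ->]]; exists t.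
apply: subvP xFa; rewrite (big_rem a) /= ?addvSl//.
by rewrite in_finite_support//; apply/mem_set; split=> //=; apply/eqP.
Qed.

(** An infinite support makes the sum zero, which is stable. *)
Lemma limg_fsum_stable A F (f : 'End(V)) :
    (forall a, A a -> f @: F a <= F a)%VS ->
  (f @: (\big[addv/0%VS]_(a \in A) F a) <= \big[addv/0%VS]_(a \in A) F a)%VS.
Proof.
move=> fF; rewrite limg_sum.
case: finite_supportP => [_|X XA _ _]; first by rewrite !big_nil.
rewrite big_seq [X in (_ <= X)%VS]big_seq.
elim/big_ind2: _ => [|U1 U2 U3 U4 h1 h2|a aX]; first exact: sub0v.
  exact: addvS.
exact/fF/XA.
Qed.

End FiniteSums.

(** A spanning family contains a basis; applied to eigenvectors, this yields a
basis of eigenvectors. *)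
Lemma sub_basis (K : fieldType) (V : vectType K) (X : seq V) :
  exists2 Y, {subset Y <= X} & basis_of <<X>>%VS Y.
Proof.
elim: X => [|v X [Y YX]]; first exists [::] => //.
  by rewrite basisEdim span_nil sub0v dimv0.
rewrite basisEfree => /and3P[Yfree YspX XspY].
have eqYX : <<Y>>%VS = <<X>>%VS.
  by apply/eqP; rewrite eqEdim YspX (eqP Yfree).
have [vX|vX] := boolP (v \in <<X>>%VS).
  exists Y; first by move=> y /YX yX; rewrite inE yX orbT.
  by rewrite span_cons (addv_idPr _) ?basisEfree ?Yfree ?YspX.
exists (v :: Y) => [y|].
  by rewrite !inE => /predU1P[->|/YX->]; rewrite ?eqxx ?orbT.
by rewrite /basis_of free_cons !span_cons eqYX eqxx vX.
Qed.

(** * Matrices of trace zero and diagonal adjoint actions *)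

Lemma trace_delta (K : pzSemiRingType) m (i j : 'I_m) :
  \tr (delta_mx i j : 'M[K]_m) = (i == j)%:R.
Proof.
rewrite /mxtrace (bigD1 i)//= mxE eqxx big1 ?addr0// => k /negPf ki.
by rewrite mxE ki.
Qed.

Lemma ad_diag (R : realType) m (H X : 'M[R[i]]_m) (i j : 'I_m) :
  is_diag_mx H -> ad H X i j = (H i i - H j j) * X i j.
Proof.
case/diag_mxP=> d ->; rewrite adE mul_diag_mx mul_mx_diag !mxE !eqxx !mulr1n.
by rewrite mulrBl [X i j * _]mulrC.
Qed.

Section Parabolic.
Variables (R : realType) (n : nat).
Local Notation C := R[i].
Local Notation N := (2 * n).+1%N.
Implicit Types (X H : 'M[C]_N) (i j : 'I_N).

(** Elementary matrices, corrected on the diagonal to have trace zero.  They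
span sl, are eigenvectors of ad H for every diagonal H, and treat root vectors
and elements of the Cartan subalgebra uniformly. *)
Definition sl_elt i j : 'M[C]_N := delta_mx i j - (i == j)%:R *: delta_mx 0 0.

Lemma sl_elt_sl i j : sl_elt i j \in sl R n.
Proof.
by rewrite mem_sl linearB linearZ /= !trace_delta eqxx mulr1 subrr.
Qed.

Lemma sl_eltE X : X \in sl R n -> X = \sum_i \sum_j X i j *: sl_elt i j.
Proof.
rewrite mem_sl => /eqP trX.
have -> : \sum_i \sum_j X i j *: sl_elt i j =
    \sum_i \sum_j X i j *: delta_mx i j - \tr X *: delta_mx 0 0.
  rewrite /mxtrace scaler_suml -sumrB; apply: eq_bigr => i _.
  under eq_bigr => j _ do rewrite scalerBr scalerA.
  rewrite sumrB -scaler_suml; congr (_ - _ *: _).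
  rewrite (bigD1 i)//= eqxx mulr1 big1 ?addr0// => j ji.
  by rewrite eq_sym (negPf ji) mulr0.
by rewrite trX scale0r subr0 -matrix_sum_delta.
Qed.

Lemma ad_diag_sl_elt H i j :
  is_diag_mx H -> ad H (sl_elt i j) = (H i i - H j j) *: sl_elt i j.
Proof.
move=> dH; apply/matrixP => a b; rewrite ad_diag// !mxE.
have [<-{j}|ij] := eqVneq i j; last first.
  rewrite mul0r subr0.
  by have [->|] := eqVneq a i; have [->|] := eqVneq b j; rewrite //= !mulr0.
have [<-|ab] := eqVneq a b; first by rewrite !subrr !mul0r.
have offdiag k : (a == k) && (b == k) = false.
  by apply: contra_neqF ab => /andP[/eqP-> /eqP->].
by rewrite !offdiag mulr0 subr0 !mulr0.
Qed.


(** * The parabolic subalgebra of a diagonal element *)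

Definition supported (r : 'I_N -> 'I_N -> Prop) X : Prop :=
  forall i j, X i j != 0 -> r i j.

Lemma supported0 r : supported r 0.
Proof. by move=> i j; rewrite mxE eqxx. Qed.

Lemma supportedD r X Y : supported r X -> supported r Y -> supported r (X + Y).
Proof.
move=> rX rY i j; rewrite mxE; have [->|Xij _] := eqVneq (X i j) 0.
  by rewrite add0r; apply: rY.
exact: rX.
Qed.

(** Subspaces are compared through the spanning matrices [sl_elt i j] that are
allowed: the coefficient of X on [sl_elt i j] is the entry X i j, also for
i = j. *)
Lemma supported_sub r X (V : {vspace 'M[C]_N}) :
    X \in sl R n -> supported r X ->
  (forall i j, r i j -> sl_elt i j \in V) -> X \in V.
Proof.
move=> /sl_eltE XE rX rV; rewrite XE; apply: rpred_sum => i _.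
apply: rpred_sum => j _; have [->|Xij] := eqVneq (X i j) 0.
  by rewrite scale0r mem0v.
by apply/rpredZ/rV/rX.
Qed.

(** Being an eigenvector of ad H determines the eigenvalue from any nonzero
entry, hence bounds the positions of nonzero entries. *)
Lemma ad_eigenvalue H X (a : C) i j : is_diag_mx H ->
  X \in ad_eigenspace (sl R n) H a -> X i j != 0 -> a = H i i - H j j.
Proof.
move=> dH; rewrite mem_ad_eigenspace => /andP[_ /eqP /matrixP/(_ i j)].
by rewrite ad_diag// mxE => /mulIf h /h.
Qed.

Lemma ad_eigenspace_neq0 H (a : C) : is_diag_mx H ->
    ad_eigenspace (sl R n) H a != 0%VS ->
  exists i j, a = H i i - H j j.
Proof.
move=> dH a0; have := memv_pick (ad_eigenspace (sl R n) H a).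
move: a0; rewrite -vpick0 => /matrix0Pn[i [j Xij]] Xa.
by exists i, j; apply: ad_eigenvalue Xij.
Qed.

Lemma sl_elt_eigen H i j : is_diag_mx H ->
  sl_elt i j \in ad_eigenspace (sl R n) H (H i i - H j j).
Proof. by move=> dH; rewrite mem_ad_eigenspace sl_elt_sl ad_diag_sl_elt/=. Qed.

Lemma mem_parabolic_diag H X : is_diag_mx H ->
  X \in parabolic_of (sl R n) H <->
  X \in sl R n /\ supported (fun i j => H j j <= H i i) X.
Proof.
move=> dH; split=> [|[Xsl Xr]].
  move: X; apply: fsumv_ind => [|X Y [Xsl Xr] [Ysl Yr]|a X /= a0 Xa].
  - by split; [exact: mem0v|exact: supported0].
  - by split; [exact: memvD|exact: supportedD].
  split; first by move: Xa; rewrite mem_ad_eigenspace => /andP[].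
  by move=> i j /(ad_eigenvalue dH Xa) aE; rewrite -subr_ge0 -aE.
apply: (supported_sub Xsl Xr) => i j ij.
apply: (@memv_fsum _ _ _ _ _ _ (fun p : 'I_N * 'I_N => H p.1 p.1 - H p.2 p.2)
  (H i i - H j j)) => [b _ /(ad_eigenspace_neq0 dH)[k [l ->]]||].
- by exists (k, l).
- by rewrite /= subr_ge0.
exact: sl_elt_eigen.
Qed.

Lemma hyperbolic_diag H : is_diag_mx H -> H \in sl R n ->
  (forall i, H i i \is Num.real) -> hyperbolic (sl R n) H.
Proof.
move=> dH Hsl Hreal; split; last first.
  by move=> a /(ad_eigenspace_neq0 dH)[i [j ->]]; exact: rpredB.
split=> //; pose X := [seq sl_elt p.1 p.2 | p : 'I_N * 'I_N].
have [Y YX Ybasis] := sub_basis X.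
exists Y; last first.
  move=> y /YX/mapP[[i j] _ ->]; exists (H i i - H j j).
  exact: sl_elt_eigen.
suff -> : sl R n = <<X>>%VS by [].
apply/eqP; rewrite eqEsubv; apply/andP; split.
  apply/subvP=> Z Zsl.
  apply: (@supported_sub (fun _ _ => True) _ _ Zsl) => // i j _.
  by apply/memv_span/mapP; exists (i, j); rewrite ?mem_enum.
by apply/span_subvP => _ /mapP[p _ ->]; exact: sl_elt_sl.
Qed.

(** * Roots and the standard parabolic subalgebras *)

(** Indices are numbered from 0 here, so that they are ordinals, and
[root_of k k.+1] is the simple root of Delta numbered k + 1. *)
Definition root_of (i j : nat) : weight R n := alpha R n i.+1 - alpha R n j.+1.

Lemma weightB (a b : weight R n) (H : subvs_of (cartan R n)) :
  (a - b) H = a H - b H.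
Proof. by rewrite add_lfunE opp_lfunE. Qed.

Lemma alpha_ord i (H : subvs_of (cartan R n)) :
  alpha R n i.+1 H = vsval H i i.
Proof. by rewrite alphaE /ix /= inord_val. Qed.

Lemma root_ord i j (H : subvs_of (cartan R n)) :
  root_of i j H = vsval H i i - vsval H j j.
Proof. by rewrite weightB !alpha_ord. Qed.

Lemma cartan_diag (H : subvs_of (cartan R n)) : is_diag_mx (vsval H).
Proof. by have := subvsP H; rewrite mem_cartan => /andP[]. Qed.

(** N times the fundamental coweight dual to the simple root
[root_of m m.+1]; the factor N clears denominators. *)
Definition coweight_mx (m : nat) : 'M[C]_N :=
  diag_mx (\row_i ((i <= m)%:R * N%:R - m.+1%:R)).

Lemma coweight_cartan m : (m < N)%N -> coweight_mx m \in cartan R n.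
Proof.
move=> mN; rewrite mem_cartan diag_mx_is_diag andbT mxtrace_diag.
under eq_bigr do rewrite mxE.
rewrite sumrB -mulr_suml sumr_const card_ord -natr_sum.
rewrite mulr_natr (_ : (\sum_(i < N) (i <= m))%N = m.+1) ?subrr//.
under eq_bigr => i _ do rewrite -ltnS.
rewrite -big_mkcond /= -(big_ord_widen _ (fun=> 1%N)) //.
by rewrite sum_nat_const card_ord muln1.
Qed.

Lemma coweightP (m : nat) : (m < N)%N -> exists H : subvs_of (cartan R n),
  forall i j : nat, (i < N)%N -> (j < N)%N ->
    root_of i j H = ((i <= m)%:R - (j <= m)%:R) * N%:R.
Proof.
move=> mN; exists (Subvs (coweight_cartan mN)) => i j iN jN.
rewrite (root_ord (Ordinal iN) (Ordinal jN)) /= !mxE !eqxx !mulr1n.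
by rewrite opprB addrA subrK -mulrBl.
Qed.

Lemma DeltaE (b : weight R n) :
  Delta R n b <-> exists2 k, (k < 2 * n)%N & b = root_of k k.+1.
Proof.
split=> [[[|k] //= kn <-]|[k kn ->]]; first by exists k.
by exists k.+1.
Qed.

(** Evaluation at H is additive, so a property of the values closed under sums
passes from S to its non-negative combinations. *)
Lemma NN_ind (S : set (weight R n)) (P : C -> Prop) (H : subvs_of (cartan R n))
    (a : weight R n) :
    P 0 -> (forall x y, P x -> P y -> P (x + y)) ->
    (forall b, S b -> P (b H)) -> NN S a -> P (a H).
Proof.
move=> P0 PD PS [s [c [sS ->]]].
rewrite sum_lfunE big_seq; elim/big_ind: _ => // b bs.
rewrite -scaler_nat scale_lfunE scaler_nat.
elim: (c b) => [|k IHk]; first by rewrite mulr0n.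
by rewrite mulrS; apply: PD => //; apply/PS/sS.
Qed.

(** A positive root is the telescoping sum of the simple roots between its
indices. *)
Lemma root_NN (S : set (weight R n)) (i j : nat) : (i <= j)%N ->
  (forall k, (i <= k < j)%N -> S (root_of k k.+1)) -> NN S (root_of i j).
Proof.
move=> ij Sk.
exists [seq root_of k k.+1 | k <- index_iota i j], (fun=> 1%N); split.
  by move=> _ /mapP[k + ->]; rewrite mem_index_iota => /Sk.
rewrite big_map (@telescope_sumr_eq _ _ _ (fun k => - alpha R n k.+1)) //.
  by rewrite opprK addrC.
by move=> k _; rewrite mulr1n opprK addrC.
Qed.

Lemma sl_elt_root_space i j : sl_elt i j \in root_space (root_of i j).
Proof.
apply/mem_root_space; split=> [|H]; first exact: sl_elt_sl.
by rewrite ad_diag_sl_elt ?cartan_diag// root_ord.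
Qed.

(** A weight is a function on the whole Cartan subalgebra, so one nonzero entry
of a vector of weight a determines a. *)
Lemma root_spaceE (a : weight R n) X i j :
  X \in root_space a -> X i j != 0 -> a = root_of i j.
Proof.
case/mem_root_space=> _ aX Xij; apply/lfunP => H.
rewrite root_ord; have /matrixP/(_ i j) := aX H.
by rewrite ad_diag ?cartan_diag// mxE => /(mulIf Xij).
Qed.

Lemma root_space_neq0 (a : weight R n) : root_space a != 0%VS ->
  exists i j, a = root_of i j.
Proof.
move=> a0; have := memv_pick (root_space a).
move: a0; rewrite -vpick0 => /matrix0Pn[i [j Xij]] Xa.
by exists i, j; apply: root_spaceE Xij.
Qed.


(** The coweight of a simple root k between i and j takes a nonzero value on the
root (i, j), but vanishes on every simple root other than k: so k has to occur
in any expression of that root. *)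
Lemma NN_root (S : set (weight R n)) i j : S `<=` Delta R n ->
  NN S (root_of i j) -> forall k, (i <= k < j)%N -> S (root_of k k.+1).
Proof.
move=> SD Sij k /andP[ik kj]; apply: contrapT => Sk.
have kN : (k < N)%N := ltn_trans kj (ltn_ord j).
have [H rH] := coweightP kN.
have : root_of i j H = 0.
  apply: (NN_ind (P := eq^~ 0) _ _ _ Sij) => // [x y -> ->|b Sb].
    by rewrite addr0.
  have /DeltaE[l ln bE] := SD _ Sb.
  have lk : l != k by apply: contra_notN Sk => /eqP <-; rewrite -bE.
  rewrite bE (rH l l.+1 (ltnW ln) ln) ltn_neqAle lk subrr mul0r//.
rewrite rH ?ltn_ord// ik leqNgt kj subr0 mul1r => /eqP.
by rewrite pnatr_eq0.
Qed.

(** For j < i, the coweight of j is negative on the root (i, j) and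
non-negative on Delta. *)
Lemma Phi_plus_root i j : Phi_plus R n (root_of i j) <-> (i < j)%N.
Proof.
split=> [[[a0 _] Dij]|ij].
  have : i != j by apply: contraNneq a0 => ->; rewrite /root_of subrr.
  rewrite neq_ltn => /orP[//|ji].
  have [H rH] := coweightP (ltn_ord j).
  have : 0 <= root_of i j H.
    apply: (NN_ind (P := fun x => 0 <= x) _ _ _ Dij) => //.
      by move=> x y; exact: addr_ge0.
    move=> _ /DeltaE[l ln ->].
    rewrite (rH l l.+1 (ltnW ln) ln) mulr_ge0// subr_ge0 ler_nat.
    by case: ltnP => // /ltnW->.
  rewrite rH ?ltn_ord// leqnn leqNgt ji sub0r mulN1r oppr_ge0.
  by rewrite lern0.
split; last first.
  apply: root_NN (ltnW ij) _ => k /andP[_ kj]; apply/DeltaE; exists k => //.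
  by rewrite -ltnS (leq_trans _ (ltn_ord j)).
split.
  have [H rH] := coweightP (ltn_ord i).
  apply/eqP => r0; move: (rH i j (ltn_ord i) (ltn_ord j)) => /eqP.
  by rewrite r0 lfunE leqnn leqNgt ij subr0 mul1r eq_sym pnatr_eq0.
apply/eqP => r0; have := sl_elt_root_space i j.
rewrite r0 memv0 => /eqP/matrixP/(_ i j)/eqP; rewrite !mxE !eqxx.
by rewrite -val_eqE /= ltn_eqF// mul0r subr0 oner_eq0.
Qed.

(** The condition is vacuous when i <= j: it constrains only the positions below
the diagonal. *)
Definition std_rel (Pi : set (weight R n)) i j : Prop :=
  forall k, (j <= k < i)%N -> Pi (root_of k k.+1).

Lemma mem_std_parabolic Pi X : Pi `<=` Delta R n ->
  X \in std_parabolic Pi <-> X \in sl R n /\ supported (std_rel Pi) X.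
Proof.
move=> PiD.
have rootN i j : - root_of i j = root_of j i by rewrite opprB.
split=> [/memv_addP[_ /memv_addP[A cA [B sB ->]] [D sD ->]]|[Xsl Xr]].
  have [Bsl Br] : B \in sl R n /\ supported (std_rel Pi) B.
    move: B sB; apply: fsumv_ind => [|Y Z [Ysl Yr] [Zsl Zr]|a Y aP aY].
    - by split; [exact: mem0v|exact: supported0].
    - by split; [exact: memvD|exact: supportedD].
    split=> [|i j /(root_spaceE aY) aE]; first by case/mem_root_space: aY.
    move: aP; rewrite aE => /Phi_plus_root ij k /andP[jk /(leq_ltn_trans jk)].
    by rewrite ltnNge ltnW.
  have [Dsl Dr] : D \in sl R n /\ supported (std_rel Pi) D.
    move: D sD; apply: fsumv_ind => [|Y Z [Ysl Yr] [Zsl Zr]|a Y [aP _] aY].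
    - by split; [exact: mem0v|exact: supported0].
    - by split; [exact: memvD|exact: supportedD].
    split=> [|i j /(root_spaceE aY)/eqP]; first by case/mem_root_space: aY.
    rewrite eqr_oppLR rootN => /eqP aE.
    by move: aP; rewrite aE => /NN_root; apply.
  move: cA; rewrite mem_cartan -mem_sl => /andP[Asl /is_diag_mxP Ad].
  split; first by rewrite !memvD.
  apply: supportedD Dr; apply: supportedD Br => i j Aij k.
  have [->|/Ad] := eqVneq (i : nat) j; last by move/eqP; rewrite (negPf Aij).
  by move=> /andP[jk /(leq_ltn_trans jk)]; rewrite ltnn.
apply: (supported_sub Xsl Xr) => i j ijP; rewrite /std_parabolic.
have [ij|ji|/val_inj <-] := ltngtP i j.
- apply: subvP (addvSl _ _) _ _; apply: subvP (addvSr _ _) _ _.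
  apply: (@memv_fsum _ _ _ _ _ _ (fun p : 'I_N * 'I_N => root_of p.1 p.2)
    (root_of i j)) => [b _ /root_space_neq0[k [l ->]]||].
  + by exists (k, l).
  + exact/Phi_plus_root.
  exact: sl_elt_root_space.
- apply: subvP (addvSr _ _) _ _.
  apply: (@memv_fsum _ _ _ _ _ _ (fun p : 'I_N * 'I_N => root_of p.1 p.2)
    (root_of j i)) => [b _ /root_space_neq0[k [l bE]]||].
  + by exists (l, k); rewrite /= -rootN -bE opprK.
  + by split; [apply: root_NN (ltnW ji) _|apply/Phi_plus_root].
  by rewrite rootN; exact: sl_elt_root_space.
apply: subvP (addvSl _ _) _ _; apply: subvP (addvSl _ _) _ _.
rewrite mem_cartan -mem_sl sl_elt_sl /=; apply/is_diag_mxP => a b ab.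
have offdiag (k : 'I_N) : (a == k) && (b == k) = false.
  by apply: contra_neqF ab => /andP[/eqP-> /eqP->].
by rewrite !mxE !offdiag mulr0 subr0.
Qed.

(** * The twist fixing the orthogonal algebra *)

(** Entries of the antidiagonal Gram matrix of the polar form.  The middle one
is 2, since the square of the middle coordinate occurs once in the quadratic
form whereas each pair of opposite coordinates contributes one product. *)
Definition form_weight i : C := 1 + (i == n :> nat)%:R.

Definition gram : 'M[C]_N :=
  \matrix_(i, j) ((j == rev_ord i)%:R * form_weight i).

Definition gram_inv : 'M[C]_N :=
  \matrix_(i, j) ((j == rev_ord i)%:R * (form_weight i)^-1).

Lemma form_weight_neq0 i : form_weight i != 0.
Proof. by rewrite /form_weight addrC natr1 pnatr_eq0. Qed.

Lemma form_weight_rev i : form_weight (rev_ord i) = form_weight i.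
Proof.
rewrite /form_weight; congr (_ + _%:R); congr nat_of_bool.
by have := ltn_ord i; rewrite /=; lia.
Qed.

Lemma mul_gramE p (X : 'M[C]_(N, p)) i (j : 'I_p) :
  (gram *m X) i j = form_weight i * X (rev_ord i) j.
Proof.
rewrite mxE (bigD1 (rev_ord i))//= mxE eqxx mul1r big1 ?addr0// => k /negPf ki.
by rewrite mxE ki !mul0r.
Qed.

Lemma mul_gram_invE p (X : 'M[C]_(N, p)) i (j : 'I_p) :
  (gram_inv *m X) i j = (form_weight i)^-1 * X (rev_ord i) j.
Proof.
rewrite mxE (bigD1 (rev_ord i))//= mxE eqxx mul1r big1 ?addr0// => k /negPf ki.
by rewrite mxE ki !mul0r.
Qed.

Lemma mul_gram_inv_gram : gram_inv *m gram = 1%:M.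
Proof.
apply/matrixP=> i j; rewrite mul_gram_invE !mxE rev_ordK form_weight_rev eq_sym.
by rewrite mulrCA mulVf ?form_weight_neq0 ?mulr1.
Qed.

Lemma polar_formE (z w : 'cV[C]_N) :
  polar_form z w = (z^T *m gram *m w) 0 0.
Proof.
pose F (u v : 'cV[C]_N) k := u (inord k) 0 * v (inord (2 * n - k)) 0.
have quadE (u : 'cV[C]_N) : quad_form u = \sum_(0 <= k < n.+1) F u u k.
  rewrite /quad_form big_add1 /=; apply: eq_bigr => k _.
  by rewrite /F /ix; congr (_ * u (inord _) _); lia.
have -> : polar_form z w =
    \sum_(0 <= k < n.+1) F z w k + \sum_(0 <= k < n.+1) F w z k.
  rewrite /polar_form !quadE -!sumrB -big_split /=; apply: eq_bigr => k _.
  rewrite /F !mxE mulrDl !mulrDr.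
  ring.
(* Reversing the indices makes both sums range over F z w; the middle index n
   is in both ranges. *)
have -> : \sum_(0 <= k < n.+1) F w z k = \sum_(n <= k < N) F z w k.
  rewrite big_nat_rev /= [RHS](@big_addn _ _ _ 0 N n).
  rewrite (_ : N - n = n.+1)%N; last by lia.
  rewrite !big_nat; apply: eq_bigr => k kn.
  by rewrite /F mulrC; congr (z (inord _) _ * w (inord _) _); lia.
rewrite -mulmxA mxE.
have -> : \sum_i z^T 0 i * (gram *m w) i 0 =
    \sum_(0 <= k < N) (F z w k + if k == n then F z w k else 0).
  rewrite big_mkord; apply: eq_bigr => i _.
 rewrite [z^T _ _]mxE mul_gramE mulrCA mulrDl mul1r /F inord_val.
  rewrite (_ : inord (2 * n - i) = rev_ord i); last first.
    by apply: val_inj; rewrite /= inordK; lia.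
  by case: eqP; rewrite ?mul1r ?mul0r.
rewrite big_split /= -big_mkcond /= [in RHS](@big_cat_nat _ _ _ n)//;
  last by lia.
rewrite (@big_nat_recr _ _ _ n 0)//= -!addrA; congr (_ + _).
rewrite addrC; congr (_ + _).
by rewrite big_nat1_eq ifT//; lia.
Qed.

Lemma soP X : so R n X <-> X \in sl R n /\ X^T *m gram = - (gram *m X).
Proof.
split=> -[Xsl XB]; split=> //.
  apply/eqP; rewrite -addr_eq0; apply/eqP/matrixP => i j.
  have := XB (delta_mx i 0) (delta_mx j 0).
  rewrite !polar_formE trmx_mul trmx_delta !mulmxA -!mulmxA.
  rewrite !(mulmxA _ _ (delta_mx j 0)) -!rowE -!colE.
  by rewrite !mxE.
move=> z w; rewrite !polar_formE trmx_mul -!mulmxA.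
rewrite [X^T *m _]mulmxA XB mulNmx mulmxN !mulmxA.
by rewrite [in X in X + _]mxE addNr.
Qed.

(** For the adjoint X^* of X relative to the polar form, this is - X^*; its
fixed points in sl are exactly the orthogonal algebra. *)
Definition twist X : 'M[C]_N := - (gram_inv *m X^T *m gram).

Fact twist_is_linear : linear twist.
Proof.
move=> c X Y; rewrite /twist linearP /= mulmxDr mulmxDl -scalemxAr -scalemxAl.
by rewrite opprD scalerN.
Qed.
HB.instance Definition _ :=
  GRing.isLinear.Build C 'M[C]_N 'M[C]_N _ _ twist_is_linear.

(** Up to nonzero factors, the twist reflects a matrix in its antidiagonal. *)
Lemma twistE X i j :
  twist X i j =
    - ((form_weight i)^-1 * X (rev_ord j) (rev_ord i) * form_weight j).
Proof.
rewrite !mxE (bigD1 (rev_ord j))//= mul_gram_invE !mxE rev_ordK eqxx mul1r.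
rewrite form_weight_rev big1 ?addr0// => k kj.
rewrite [gram k j]mxE [j == _](_ : _ = false) ?mul0r ?mulr0//.
by apply: contraNF kj => /eqP->; rewrite rev_ordK.
Qed.

Lemma trace_twist X : \tr (twist X) = - \tr X.
Proof.
rewrite linearN /= -mulmxA mxtrace_mulC -mulmxA (mulmx1C mul_gram_inv_gram).
by rewrite mulmx1 mxtrace_tr.
Qed.

(** Taking minus the adjoint respects brackets and fixes H. *)
Lemma twist_ad H X : so R n H -> twist (ad H X) = ad H (twist X).
Proof.
case/soP=> _ HB; have HG : H *m gram_inv = - (gram_inv *m H^T).
  rewrite -[LHS]mul1mx -mul_gram_inv_gram -mulmxA (mulmxA gram).
  rewrite -[gram *m H]opprK -HB.
  by rewrite mulNmx -!mulmxA (mulmx1C mul_gram_inv_gram) mulmx1 mulmxN.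
rewrite !adE /twist linearB /= !trmx_mul mulmxBr mulmxBl mulmxN mulNmx opprK.
rewrite !mulmxA HG -!mulmxA.
rewrite -[gram *m H]opprK -HB mulNmx !mulmxN !opprK opprB.
by rewrite !mulmxA.
Qed.

Lemma twist_parabolic H X : so R n H ->
  X \in parabolic_of (sl R n) H -> twist X \in parabolic_of (sl R n) H.
Proof.
move=> Hso Xp; rewrite -[twist X](lfunE twist).
set p := parabolic_of _ _ in Xp *.
suff /subvP : (linfun twist @: p <= p)%VS.
  by apply; exact: memv_img.
rewrite /p /parabolic_of; apply: limg_fsum_stable => a _.
apply/subvP=> _ /memv_imgP[Y Ya ->]; move: Ya; rewrite lfunE !mem_ad_eigenspace.
rewrite !mem_sl trace_twist oppr_eq0 => /andP[-> /eqP aY].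
by rewrite -twist_ad// aY linearZ /=.
Qed.

(** * Symmetry of the set of simple roots *)

(** The simple roots numbered m and 2n - 1 - m are exchanged by the diagram
automorphism; closure under it is symmetry, the map being an involution. *)
Definition mirror_closed (Pi : set (weight R n)) : Prop :=
  forall m, (m < 2 * n)%N ->
    Pi (root_of m m.+1) -> Pi (root_of (2 * n - m.+1) (2 * n - m.+1).+1).

Lemma std_parabolic_mirror H Pi : Pi `<=` Delta R n -> so R n H ->
  std_parabolic Pi = parabolic_of (sl R n) H -> mirror_closed Pi.
Proof.
move=> PiD Hso pE m mn Pim.
pose i : 'I_N := Ordinal (mn : (m.+1 < N)%N).
pose j : 'I_N := Ordinal (ltnW mn : (m < N)%N).
have ij : (i == j) = false by rewrite -val_eqE /= gtn_eqF.
have Xp : sl_elt i j \in std_parabolic Pi.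
  apply/(mem_std_parabolic _ PiD); split=> [|a b]; first exact: sl_elt_sl.
  rewrite !mxE ij mul0r subr0.
  have [->|_] := eqVneq a i; have [->|_] := eqVneq b j;
    rewrite /= ?eqxx// => _ k.
  by rewrite ltnS -eqn_leq => /eqP <-.
have : twist (sl_elt i j) \in std_parabolic Pi.
  by rewrite pE; apply: twist_parabolic; rewrite -?pE.
case/(mem_std_parabolic _ PiD) => _ /(_ (rev_ord j) (rev_ord i)); apply.
  rewrite twistE !rev_ordK !mxE ij mul0r subr0 !eqxx mulr1 oppr_eq0.
  by rewrite mulf_neq0 ?invr_neq0 ?form_weight_neq0.
rewrite /=; lia.
Qed.

(** * A diagonal element defining a standard parabolic subalgebra *)

(** The number of simple roots outside Pi before position k, that is, the index
of the diagonal block of the Levi subalgebra to which k belongs. *)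
Definition level (Pi : set (weight R n)) (k : nat) : nat :=
  \sum_(0 <= m < k) ~~ `[< Pi (root_of m m.+1) >].

Lemma level_le Pi i j : (level Pi i <= level Pi j)%N <-> std_rel Pi i j.
Proof.
have [ij|ji] := leqP i j.
  split=> [_ k /andP[jk ki]|_].
    by have := leq_trans (leq_ltn_trans jk ki) ij; rewrite ltnn.
  by rewrite /level (@big_cat_nat _ _ _ i 0 j)//= leq_addr.
rewrite {1}/level (@big_cat_nat _ _ _ j 0 i)//= ?(ltnW ji)// -/(level Pi j).
rewrite -[X in (_ <= X)%N]addn0 leq_add2l leqn0 sum_nat_seq_eq0; split.
  move=> /allP ji0 k kji; apply/asboolP; have := ji0 k; rewrite mem_index_iota.
  by move=> /(_ kji)/=; rewrite eqb0 negbK.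
move=> Pik; apply/allP => k; rewrite mem_index_iota => /Pik/asboolP /= Pk.
by rewrite eqb0 negbK.
Qed.

Lemma level_rev Pi k : mirror_closed Pi ->
  (k <= 2 * n)%N -> (level Pi (2 * n - k) + level Pi k = level Pi (2 * n))%N.
Proof.
move=> sym kn; rewrite addnC {3}/level (@big_cat_nat _ _ _ k)//=.
congr (_ + _)%N.
rewrite [RHS](@big_addn _ _ _ 0 _ k) /level big_nat_rev /= !big_nat.
apply: eq_bigr => m mk; congr (nat_of_bool (~~ _)).
have e : (2 * n - (m + k).+1 = 0 + (2 * n - k) - m.+1)%N by lia.
apply/asbool_equiv_eq; split=> /sym; last by rewrite e; apply; lia.
rewrite -e (_ : 2 * n - (2 * n - (m + k).+1).+1 = m + k)%N; last by lia.
by apply; lia.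
Qed.

(** The entries decrease by 2 each time the level increases by 1.  Subtracting
twice the level from the highest level centres them without division: they are
antisymmetric under reversal as soon as Pi is symmetric. *)
Definition grading_elt (Pi : set (weight R n)) : 'M[C]_N :=
  diag_mx (\row_i ((level Pi (2 * n))%:R - (level Pi i).*2%:R)).

Lemma grading_eltE Pi i :
  grading_elt Pi i i = (level Pi (2 * n))%:R - (level Pi i).*2%:R.
Proof. by rewrite !mxE eqxx mulr1n. Qed.

Lemma grading_elt_rev Pi i : mirror_closed Pi ->
  grading_elt Pi (rev_ord i) (rev_ord i) = - grading_elt Pi i i.
Proof.
move=> sym; rewrite !grading_eltE /= subSS.
rewrite -(level_rev sym (ltn_ord i : (i <= 2 * n)%N)) -!addnn !natrD.
ring.
Qed.

Lemma grading_elt_so Pi : mirror_closed Pi -> so R n (grading_elt Pi).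
Proof.
move=> sym; apply/soP; split.
  set H := grading_elt Pi; rewrite mem_sl.
  have : \tr H = - \tr H.
    rewrite {1}/mxtrace (reindex_inj rev_ord_inj) /= -sumrN.
    by apply: eq_bigr => i _; exact: grading_elt_rev.
  by move/eqP; rewrite -addr_eq0 -mulr2n mulrn_eq0.
apply/matrixP=> i j; rewrite tr_diag_mx mul_diag_mx mul_mx_diag !mxE.
have [->|] := eqVneq j (rev_ord i); last by rewrite !mul0r mulr0 oppr0.
have := grading_elt_rev i sym; rewrite !grading_eltE => ->.
by rewrite mulrN opprK mulrC.
Qed.

Lemma grading_elt_parabolic Pi : Pi `<=` Delta R n ->
  std_parabolic Pi = parabolic_of (sl R n) (grading_elt Pi).
Proof.
move=> PiD; apply/vspaceP => X; apply/idP/idP.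
  move/(mem_std_parabolic _ PiD) => [Xsl Xr].
  apply/mem_parabolic_diag; first exact: diag_mx_is_diag.
  split=> // i j /Xr/level_le; rewrite !grading_eltE lerD2l lerN2 ler_nat.
  by rewrite leq_double.
move/(mem_parabolic_diag _ (diag_mx_is_diag _)) => [Xsl Xr].
apply/(mem_std_parabolic _ PiD); split=> // i j /Xr.
rewrite !grading_eltE lerD2l lerN2 ler_nat leq_double.
by move/level_le.
Qed.

End Parabolic.

Arguments root_of {R n} i%_N j%_N.

Theorem proposition7 (R : realType) (n : nat) (hn : (1 <= n)%N)
    (Pi : set (weight R n)) (hPi : Pi `<=` Delta R n) :
  compatible (sl R n) (so R n) (std_parabolic Pi) <->
  forall k : nat, (1 <= k <= n)%N ->
    [set alpha R n k - alpha R n k.+1;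
         alpha R n (2 * n + 1 - k)%N - alpha R n (2 * n + 2 - k)%N] `<=` Pi \/
    [set alpha R n k - alpha R n k.+1;
         alpha R n (2 * n + 1 - k)%N - alpha R n (2 * n + 2 - k)%N] `&` Pi = set0.
Proof.
have mirrorE k : (k < n)%N ->
    alpha R n (2 * n + 1 - k.+1)%N - alpha R n (2 * n + 2 - k.+1)%N =
    root_of (2 * n - k.+1)%N (2 * n - k.+1).+1%N.
  by move=> kn; congr (alpha R n _ - alpha R n _); lia.
split=> [[H [Hso _ pE]] [//|k] kn|pairs].
  rewrite mirrorE// -/(root_of k k.+1).
  have sym := std_parabolic_mirror hPi Hso pE.
  have [Pk|nPk] := pselect (Pi (root_of k k.+1)).
    by left=> _ [->|->] //; apply: sym => //; lia.
  right; rewrite -subset0 => a [[->|->] Pa]; apply: nPk => //.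
  have := sym _ _ Pa.
  rewrite (_ : (2 * n - (2 * n - k.+1).+1 = k)%N); last by lia.
  by apply; lia.
have sym m : (m < 2 * n)%N -> Pi (root_of m m.+1) ->
    Pi (root_of (2 * n - m.+1)%N (2 * n - m.+1).+1%N).
  move=> mn Pm; have [mltn|nlem] := ltnP m n.
    have := pairs m.+1; rewrite mirrorE// => /(_ mltn)[|p0].
      by apply; right.
    suff : set0 (root_of (R := R) (n := n) m m.+1) by [].
    by rewrite -p0; split=> //; left.
  have kn : (2 * n - m.+1 < n)%N by lia.
  have := pairs (2 * n - m.+1).+1; rewrite mirrorE//.
  rewrite (_ : 2 * n - (2 * n - m.+1).+1 = m)%N; last by lia.
  move=> /(_ kn)[|p0]; first by apply; left.
  suff : set0 (root_of (R := R) (n := n) m m.+1) by [].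
  by rewrite -p0; split=> //; right.
have Hso := grading_elt_so sym.
exists (grading_elt Pi); split=> //; last exact: grading_elt_parabolic.
apply: hyperbolic_diag; first exact: diag_mx_is_diag.
  by case: Hso.
by move=> i; rewrite grading_eltE rpredB ?realn.
Qed.
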